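(* Let $m,n,m',n',r,s$ be positive integers with $m'r$ even. Suppose there exists a shiftable $SMR(m,n;r,s)$ and there exists an $SMR(m',n';r,s)$. Then for every integer $k\geq 1$ there exists an $SMR(km+m',kn+n';r,s)$; moreover, if the given $SMR(m',n';r,s)$ is shiftable, then there exists a shiftable $SMR(km+m',kn+n';r,s)$.
   Context: A signed magic rectangle $SMR(m,n;r,s)$ is an $m\times n$ array, some of whose cells are filled with integers and the others empty, such that exactly $r$ cells in every row and exactly $s$ cells in every column are filled (so $mr=ns$), every element of a set $X$ appears exactly once in the array, and the sum of the entries of each row and of each column is zero. Here $X=\{\pm1,\pm2,\ldots,\pm mr/2\}$ if $mr$ is even, and $X=\{0,\pm1,\ldots,\pm (mr-1)/2\}$ if $mr$ is odd. An array is shiftable if every row and every column contains the same number of positive entries as negative entries. *)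

(* Defs.v *)
From mathcomp Require Import all_boot all_order all_algebra.

Set Implicit Arguments.
Unset Strict Implicit.
Unset Printing Implicit Defensive.

Import Order.TTheory GRing.Theory Num.Theory.
Local Open Scope ring_scope.

(* A partially filled m x n array of integers is an 'M[option int]_(m, n);
   None marks an empty cell. *)

(* The set X for N = m * r filled cells: {+-1, ..., +-N/2} if N is even,
   {0, +-1, ..., +-(N-1)/2} if N is odd; here `|x|%N : nat. *)
Definition smr_set (N : nat) : pred int := fun x =>
  if odd N then (`|x| <= N.-1./2)%N else (1 <= `|x| <= N./2)%N.

(* An empty cell counts as 0, so it contributes to no sum and is neither
   positive nor negative. *)
Definition cellval (c : option int) : int := odflt 0 c.

(* There are exactly m * r filled cells and smr_set (m * r) has m * r elements,
   so the third clause also forces every entry to lie in smr_set (m * r). *)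
Definition is_SMR (m n r s : nat) (A : 'M[option int]_(m, n)) : Prop :=
  [/\ forall i, #|[set j | isSome (A i j)]| = r,
      forall j, #|[set i | isSome (A i j)]| = s,
      forall x : int, smr_set (m * r) x ->
        #|[set ij : 'I_m * 'I_n | A ij.1 ij.2 == Some x]| = 1%N,
      forall i, \sum_j cellval (A i j) = 0
    & forall j, \sum_i cellval (A i j) = 0].

Definition shiftable (m n : nat) (A : 'M[option int]_(m, n)) : Prop :=
  (forall i, #|[set j | 0 < cellval (A i j)]| = #|[set j | cellval (A i j) < 0]|)
  /\ (forall j, #|[set i | 0 < cellval (A i j)]| = #|[set i | cellval (A i j) < 0]|).

(* Main.v *)
(** Shift the entries of [A] away from 0 by [m' * r / 2], so that they become
    exactly the values missing from [B], and place the two arrays as diagonal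
    blocks; shiftability of [A] keeps its row and column sums zero. Iterating
    [k] times gives the result, provided that [m * r] is even. If it is odd,
    then each row of the shiftable array [A] contains a 0, so [m = 1] and
    [s = 1], and the entry 1 of [B] would be alone in a column of sum zero. *)
Require Import Defs.
From mathcomp Require Import all_boot all_order all_algebra.
From mathcomp Require Import zify.

Set Implicit Arguments.
Unset Strict Implicit.
Unset Printing Implicit Defensive.

Import Order.TTheory GRing.Theory Num.Theory.

Lemma card_split_ord (p q : nat) (P : pred 'I_(p + q)) :
  #|[set j | P j]| =
    #|[set j | P (lshift q j)]| + #|[set j | P (rshift p j)]|.
Proof.
rewrite -!sum1dep_card big_split_ord /=.
by congr (_ + _); apply: eq_bigl => j; rewrite inE.
Qed.

Lemma card_pairs (S T : finType) (P : S -> T -> bool) :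
  #|[set ij : S * T | P ij.1 ij.2]| = \sum_i #|[set j | P i j]|.
Proof.
rewrite -sum1dep_card -(pair_big_dep xpredT P (fun _ _ => 1)) /=.
by apply: eq_bigr => i _; rewrite sum1dep_card.
Qed.

Lemma sum_sgz (T : finType) (f : T -> int) :
  (\sum_j sgz (f j) =
     #|[set j | (0 < f j)%R]|%:Z - #|[set j | (f j < 0)%R]|%:Z)%R.
Proof.
have cardZ (P : pred T) : (#|[set j | P j]|%:Z = \sum_j (P j)%:R)%R.
  rewrite -sum1dep_card -natz natr_sum big_mkcond /=.
  by apply: eq_bigr => j _; case: (P j).
by rewrite !cardZ -sumrB; apply: eq_bigr => j _; case: sgzP.
Qed.

(** The factor [sgz x] keeps every sign, and so every balance of signs. A filled 0 would stay at
    0. *)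
Definition shift_cell (d : nat) : option int -> option int :=
  omap (fun x => x + sgz x * d%:Z)%R.

Lemma isSome_shift_cell d c : isSome (shift_cell d c) = isSome c.
Proof. by case: c. Qed.

Lemma cellval_shift d c :
  cellval (shift_cell d c) = (cellval c + sgz (cellval c) * d%:Z)%R.
Proof. by case: c => //=; rewrite /cellval /= sgz0 mul0r addr0. Qed.

Lemma cellval_shift_gt0 d c :
  (0 < cellval (shift_cell d c))%R = (0 < cellval c)%R.
Proof. by rewrite cellval_shift; case: (sgzP (cellval c)) => h; lia. Qed.

Lemma cellval_shift_lt0 d c :
  (cellval (shift_cell d c) < 0)%R = (cellval c < 0)%R.
Proof. by rewrite cellval_shift; case: (sgzP (cellval c)) => h; lia. Qed.

(** Inverts the shift. The guard is essential: for [|x| < d] the candidate preimage lies across 0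
    from [x], and its own shift moves further away. The excluded entry 0, fixed by every shift,
    would break the equivalence at [x = 0]. *)
Lemma shift_cell_eq d c x : c != Some 0%R ->
  (shift_cell d c == Some x) =
    (d < `|x|) && (c == Some (x - sgz x * d%:Z)%R).
Proof.
case: c => [y|] /=; last by rewrite andbF.
rewrite !(inj_eq Some_inj).
by case: (sgzP y) => hy; case: (sgzP x) => hx h; lia.
Qed.

(** The shift changes the sum by [d] times the sum of the signs, which is 0 when positive and
    negative entries are equally many. *)
Lemma sum_cellval_shift (T : finType) d (c : T -> option int) :
  (\sum_j cellval (c j) = 0)%R ->
  #|[set j | (0 < cellval (c j))%R]| = #|[set j | (cellval (c j) < 0)%R]| ->
  (\sum_j cellval (shift_cell d (c j)) = 0)%R.
Proof.
move=> c0 cE; under eq_bigr do rewrite cellval_shift.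
by rewrite big_split /= c0 -mulr_suml sum_sgz cE subrr mul0r.
Qed.

(** Pigeonhole: the [m * r] filled cells already have to hold the [m * r] distinct values of the
    set, so no cell is left for any other value. The boolean on the right is read as 0 or 1. *)
Lemma SMR_count m n r s (A : 'M[option int]_(m, n)) x :
  ~~ odd (m * r) -> is_SMR r s A ->
  #|[set ij : 'I_m * 'I_n | A ij.1 ij.2 == Some x]| = smr_set (m * r) x.
Proof.
move=> Ne [rowA _ valA _ _].
case: (boolP (smr_set (m * r) x)) => [/valA // | xN].
pose F := [set ij : 'I_m * 'I_n | isSome (A ij.1 ij.2)].
pose vals := [seq cellval (A ij.1 ij.2) | ij <- enum F].
pose h := (m * r)./2.
(* [Negz i] is [-(i + 1)], so both halves start at absolute value 1 and end at [h]. *)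
pose X : seq int := [seq Posz i.+1 | i <- iota 0 h] ++
                    [seq Negz i | i <- iota 0 h].
have size_vals : size vals = m * r.
  rewrite size_map -cardE (card_pairs (fun i j => isSome (A i j))).
  by under eq_bigr do rewrite rowA; rewrite sum_nat_const card_ord.
have X_set y : y \in X = smr_set (m * r) y.
  rewrite /smr_set (negPf Ne) mem_cat; apply/orP/idP.
    by case=> /mapP[i]; rewrite mem_iota => hi ->; rewrite -/h; lia.
  rewrite -/h => hy; case: y hy => i hi; [left | right]; apply/mapP.
    by exists i.-1; rewrite ?mem_iota; [lia | congr Posz; lia].
  by exists i; rewrite ?mem_iota; lia.
have uX : uniq X.
  rewrite cat_uniq !map_inj_uniq ?iota_uniq ?andbT => [|i j []|i j []] //=.
  by apply/hasPn => _ /mapP[i _ ->]; apply/mapP => -[].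
have sub : {subset X <= vals}.
  move=> y; rewrite X_set => /valA /eqP/cards1P[ij ijE].
  have: ij \in [set ij] by rewrite inE.
  rewrite -ijE inE => /eqP Ay; apply/mapP; exists ij.
    by rewrite mem_enum inE Ay.
  by rewrite Ay.
have sX : size vals <= size X.
  by rewrite size_vals size_cat !size_map size_iota /h; lia.
have [_ eqX] := uniq_min_size uX sub sX.
apply: eq_card0 => ij; rewrite inE; apply/negP => /eqP Ax.
case/negP: xN; rewrite -X_set eqX; apply/mapP; exists ij; last by rewrite Ax.
by rewrite mem_enum inE Ax.
Qed.

Section Block.

Variables (m n m' n' r s : nat).
Variables (A : 'M[option int]_(m, n)) (B : 'M[option int]_(m', n')).

Definition shift_block : 'M[option int]_(m + m', n + n') :=
  block_mx (map_mx (shift_cell (m' * r)./2) A) (const_mx None)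
           (const_mx None) B.

Let blockE := (block_mxEul, block_mxEur, block_mxEdl, block_mxEdr, mxE).

(** A predicate false on empty cells does not see the off-diagonal blocks. Leaving it abstract lets
    this lemma and its three variants serve for filled cells and for both signs; the row versions
    also count a given value. *)
Lemma card_row_shift_block_l (P : pred (option int)) i : ~~ P None ->
  #|[set j | P (shift_block (lshift m' i) j)]| =
    #|[set j | P (shift_cell (m' * r)./2 (A i j))]|.
Proof.
move=> PN; rewrite card_split_ord [X in _ + X]eq_card0 ?addn0.
  by apply: eq_card => j; rewrite !inE !blockE.
by move=> j; rewrite !inE !blockE (negPf PN).
Qed.

Lemma card_row_shift_block_r (P : pred (option int)) i : ~~ P None ->
  #|[set j | P (shift_block (rshift m i) j)]| = #|[set j | P (B i j)]|.
Proof.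
move=> PN; rewrite card_split_ord [X in X + _]eq_card0 ?add0n.
  by apply: eq_card => j; rewrite !inE !blockE.
by move=> j; rewrite !inE !blockE (negPf PN).
Qed.

Lemma card_col_shift_block_l (P : pred (option int)) j : ~~ P None ->
  #|[set i | P (shift_block i (lshift n' j))]| =
    #|[set i | P (shift_cell (m' * r)./2 (A i j))]|.
Proof.
move=> PN; rewrite card_split_ord [X in _ + X]eq_card0 ?addn0.
  by apply: eq_card => i; rewrite !inE !blockE.
by move=> i; rewrite !inE !blockE (negPf PN).
Qed.

Lemma card_col_shift_block_r (P : pred (option int)) j : ~~ P None ->
  #|[set i | P (shift_block i (rshift n j))]| = #|[set i | P (B i j)]|.
Proof.
move=> PN; rewrite card_split_ord [X in X + _]eq_card0 ?add0n.
  by apply: eq_card => i; rewrite !inE !blockE.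
by move=> i; rewrite !inE !blockE (negPf PN).
Qed.

Lemma shift_block_SMR : ~~ odd (m * r) -> ~~ odd (m' * r) ->
  is_SMR r s A -> shiftable A -> is_SMR r s B -> is_SMR r s shift_block.
Proof.
move=> Ae Be A_SMR [shiftRow shiftCol] B_SMR.
have countA x := SMR_count x Ae A_SMR.
have countB x := SMR_count x Be B_SMR.
(* As [m * r] is even, 0 lies outside the value set of [A], so its count is 0. *)
have A_neq0 i j : A i j != Some 0%R.
  have := countA 0%R; rewrite {1}/smr_set (negPf Ae) /= => /cards0_eq A0.
  by have := in_set0 (i, j); rewrite -A0 inE => ->.
case: A_SMR B_SMR => [rowA colA _ sumrA sumcA] [rowB colB _ sumrB sumcB].
split.
- move=> i; case: (split_ordP i) => i' ->.
    rewrite card_row_shift_block_l //.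
    by under eq_finset do rewrite isSome_shift_cell.
  by rewrite card_row_shift_block_r.
- move=> j; case: (split_ordP j) => j' ->.
    rewrite card_col_shift_block_l //.
    by under eq_finset do rewrite isSome_shift_cell.
  by rewrite card_col_shift_block_r.
- move=> x xC; rewrite (card_pairs (fun i j => shift_block i j == Some x)).
  rewrite big_split_ord /=.
  under eq_bigr do rewrite (card_row_shift_block_l (P := pred1 (Some x))) //=.
  under [X in _ + X]eq_bigr do
    rewrite (card_row_shift_block_r (P := pred1 (Some x))) //=.
  rewrite -(card_pairs (fun i j => B i j == Some x)) countB.
  rewrite -(card_pairs (fun i j => shift_cell _ (A i j) == Some x)).
  set y := (x - sgz x * (m' * r)./2%:Z)%R.
  have -> : #|[set ij | shift_cell (m' * r)./2 (A ij.1 ij.2) == Some x]| =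
            ((m' * r)./2 < `|x|) && smr_set (m * r) y.
    under eq_finset do rewrite shift_cell_eq ?A_neq0 //.
    case: (_ < _) => /=; first exact: countA.
    by apply: eq_card0 => ij; rewrite inE.
  (* By parity the halves add up, so [1 <= |x| <= (m * r)./2 + (m' * r)./2]. Exactly one block holds
     [x]: [B] if [|x| <= (m' * r)./2], and otherwise the shifted [A], where
     [|y| = |x| - (m' * r)./2]. *)
  move: xC; rewrite /smr_set mulnDl oddD (negPf Ae) (negPf Be) /= {}/y.
  by case: (sgzP x) => hx; lia.
- move=> i; rewrite big_split_ord /=; case: (split_ordP i) => i' ->.
    rewrite [X in (_ + X)%R]big1 ?addr0 => [|j _]; last by rewrite !blockE.
    under eq_bigr do rewrite !blockE.
    exact: sum_cellval_shift.
  rewrite big1 ?add0r => [|j _]; last by rewrite !blockE.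
  by under eq_bigr do rewrite !blockE.
- move=> j; rewrite big_split_ord /=; case: (split_ordP j) => j' ->.
    rewrite [X in (_ + X)%R]big1 ?addr0 => [|i _]; last by rewrite !blockE.
    under eq_bigr do rewrite !blockE.
    exact: sum_cellval_shift.
  rewrite big1 ?add0r => [|i _]; last by rewrite !blockE.
  by under eq_bigr do rewrite !blockE.
Qed.

Lemma shift_block_shiftable :
  shiftable A -> shiftable B -> shiftable shift_block.
Proof.
pose pos c := (0 < cellval c)%R; pose neg c := (cellval c < 0)%R.
move=> [rowA colA] [rowB colB]; split.
- move=> i; case: (split_ordP i) => i' ->.
    rewrite (card_row_shift_block_l (P := pos)) //.
    rewrite (card_row_shift_block_l (P := neg)) // /pos /neg.
    under eq_finset do rewrite cellval_shift_gt0.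
    by under [in RHS]eq_finset do rewrite cellval_shift_lt0.
  rewrite (card_row_shift_block_r (P := pos)) //.
  by rewrite (card_row_shift_block_r (P := neg)) //; apply: rowB.
- move=> j; case: (split_ordP j) => j' ->.
    rewrite (card_col_shift_block_l (P := pos)) //.
    rewrite (card_col_shift_block_l (P := neg)) // /pos /neg.
    under eq_finset do rewrite cellval_shift_gt0.
    by under [in RHS]eq_finset do rewrite cellval_shift_lt0.
  rewrite (card_col_shift_block_r (P := pos)) //.
  by rewrite (card_col_shift_block_r (P := neg)) //; apply: colB.
Qed.

End Block.

(** The nonzero entries of a row split evenly by sign, so their number is even, whereas [r] is odd.
    Hence every row contains a 0, but 0 occurs only once in the array. *)
Lemma shiftable_SMR_odd m n r s (A : 'M[option int]_(m, n)) :
  odd (m * r) -> is_SMR r s A -> shiftable A -> m = 1.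
Proof.
move=> No [rowA _ valA _ _] [shiftRow _].
have /andP[m_odd r_odd] : odd m && odd r by rewrite -oddM.
have zero i : exists j, A i j == Some 0%R.
  apply/existsP; apply: contraTT r_odd => /existsPn no0.
  rewrite -(rowA i).
  have -> : [set j | isSome (A i j)] = [set j | (0 < cellval (A i j))%R]
                                   :|: [set j | (cellval (A i j) < 0)%R].
    apply/setP => j; rewrite !inE; have := no0 j.
    by case: (A i j) => //= x; rewrite (inj_eq Some_inj) /cellval /=; lia.
  rewrite cardsU shiftRow [X in _ - X]eq_card0 ?subn0 ?addnn ?odd_double //.
  by move=> j; rewrite !inE; lia.
have : smr_set (m * r) 0%R by rewrite /smr_set No.
move=> /valA; rewrite (card_pairs (fun i j => A i j == Some 0%R)) => sum1.
suff : m <= 1 by case: (m) m_odd => [|[]].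
rewrite -sum1 -[X in X <= _]card_ord -sum1_card; apply: leq_sum => i _.
by have [j Aij] := zero i; apply/card_gt0P; exists j; rewrite inE.
Qed.

(** A positive even number of cells makes 1 an entry, and its column needs a second filled cell to
    reach sum zero. *)
Lemma SMR_col_gt1 m n r s (B : 'M[option int]_(m, n)) :
  0 < m * r -> ~~ odd (m * r) -> is_SMR r s B -> 1 < s.
Proof.
move=> N_gt0 Ne [_ colB valB _ sumcB].
have /valB/eqP/cards1P[[i j] ijE] : smr_set (m * r) 1%R.
  by rewrite /smr_set (negPf Ne) /=; lia.
have : (i, j) \in [set (i, j)] by rewrite inE.
rewrite -ijE inE /= => /eqP Bij.
rewrite ltnNge -(colB j); apply/negP => s_le1.
have := sumcB j; rewrite (bigD1 i) //= Bij big1 // => i' i'i.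
case E: (B i' j) => [x|] //.
by case/eqP: i'i; apply: (card_le1_eqP s_le1); rewrite inE ?E ?Bij.
Qed.

Theorem theorem7 (m n m' n' r s : nat)
  (m_gt0 : 0 < m) (n_gt0 : 0 < n) (m'_gt0 : 0 < m') (n'_gt0 : 0 < n')
  (r_gt0 : 0 < r) (s_gt0 : 0 < s) (m'r_even : ~~ odd (m' * r))
  (A : 'M[option int]_(m, n)) (A_SMR : is_SMR r s A) (A_shift : shiftable A)
  (B : 'M[option int]_(m', n')) (B_SMR : is_SMR r s B)
  (k : nat) (k_ge1 : 1 <= k) :
  (exists C : 'M[option int]_(k * m + m', k * n + n'), is_SMR r s C)
  /\ (shiftable B ->
      exists C : 'M[option int]_(k * m + m', k * n + n'),
        is_SMR r s C /\ shiftable C).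
Proof.
have mr_even : ~~ odd (m * r).
  apply/negP => mr_odd.
  have m1 := shiftable_SMR_odd mr_odd A_SMR A_shift.
  have : 1 < s by apply: SMR_col_gt1 B_SMR => //; rewrite muln_gt0 m'_gt0.
  have [_ colA _ _ _] := A_SMR.
  (* A column of [A] has only [m = 1] cell, so [s <= 1]. *)
  rewrite -(colA (Ordinal n_gt0)) ltnNge.
  by rewrite (leq_trans (max_card _)) // card_ord m1.
(* One array serves both claims. *)
suff [C [C_SMR C_shift]] : exists C : 'M[option int]_(k * m + m', k * n + n'),
    is_SMR r s C /\ (shiftable B -> shiftable C).
  by split=> [|B_shift]; exists C; auto.
(* The induction starts at [k = 0], where the array is [B] itself. *)
clear k_ge1; elim: k => [|k [C [C_SMR C_shift]]]; first by exists B.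
(* The array built so far takes the place of [B], so each new copy of [A] is shifted past all values
   used before. Its cell count stays even because [m * r] is even. *)
rewrite !mulSn -!addnA; exists (shift_block r A C); split.
  apply: shift_block_SMR => //.
  by rewrite mulnDl oddD -mulnA oddM (negPf mr_even) andbF.
by move=> /C_shift; apply: shift_block_shiftable.
Qed.
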